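(* Let $A,B$ be logically independent events and let $A||B$ denote the biconditional event $(AB)|(A\vee B)$. Given any assessment $z\in[0,1]$ on $A||B$, the extension $(x,y)$ on $\{A|B,B|A\}$, with $x=P(A|B)$, $y=P(B|A)$, is coherent (i.e. $(x,y,z)$ is a coherent assessment on $\{A|B,\,B|A,\,A||B\}$) if and only if $(x,y)\in D_z$, where $$D_z=\begin{cases}\{(x,y)\in[0,1]^2: x=0\text{ or }y=0\},&\text{if }z=0,\\[1mm] \{(x,y)\in[0,1]^2: z\le x\le1,\ y=\frac{xz}{x-z+xz}\},&\text{if }0<z\le1.\end{cases}$$
   Context: Events are elements of a Boolean algebra with sure event $\Omega$ and impossible event $\emptyset$; $\overline{E}$ is negation, $EF$ is conjunction, and an event is identified with its $0/1$ indicator. $A,B$ are logically independent if $AB,\ A\overline B,\ \overline AB,\ \overline A\,\overline B$ are all $\neq\emptyset$. Coherence (de Finetti). A real assessment $(p_1,\dots,p_n)$ on a finite family of conditional events $\{E_1|H_1,\dots,E_n|H_n\}$ ($H_i\neq\emptyset$) is coherent if for every nonempty $S\subseteq\{1,\dots,n\}$ and all real $s_i$ ($i\in S$), the set $D$ of values of the random gain $G=\sum_{i\in S}s_iH_i(E_i-p_i)$ on the constituents (nonimpossible atoms generated by the $E_i,H_i$) contained in $\bigvee_{i\in S}H_i$ satisfies $\min D\le0\le\max D$. *)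

(* Defs.v *)
(* Library world: MathComp, with real numbers from MathComp-Analysis
   (R : realType).  A Boolean algebra is a ctbDistrLatticeType: \top is the
   sure event, \bot the impossible one, ~` negation, `&` conjunction, `|`
   disjunction. *)
From HB Require Import structures.
From mathcomp Require Import all_boot all_order all_algebra.
From mathcomp Require Import classical_sets reals.

Set Implicit Arguments.
Unset Strict Implicit.
Unset Printing Implicit Defensive.

Import Order.TTheory GRing.Theory Num.Theory.

Local Open Scope ring_scope.

Definition logically_independent (d : Order.disp_t) (T : ctbDistrLatticeType d)
    (A B : T) : Prop :=
  [/\ (A `&` B != \bot)%O, (A `&` ~` B != \bot)%O,
      (~` A `&` B != \bot)%O & (~` A `&` ~` B != \bot)%O].

(* The conditional event E | H, with E = event and H = conditioning. *)
Record cond_event (d : Order.disp_t) (T : ctbDistrLatticeType d) := CondEvent {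
  event : T;
  conditioning : T;
  conditioning_neq0 : (conditioning != \bot)%O }.

Section Coherence.
Variables (d : Order.disp_t) (T : ctbDistrLatticeType d) (R : realType).
Variables (n : nat) (F : n.-tuple (cond_event T)) (p : n.-tuple R).

Local Notation E_ i := (event (tnth F i)).
Local Notation H_ i := (conditioning (tnth F i)).

Definition literal (b : bool) (X : T) : T := if b then X else (~` X)%O.

(* The constituents are the elements signed_meet e that differ from \bot. *)
Definition signed_meet (e : {ffun 'I_n -> bool * bool}) : T :=
  (\meet_(i < n) (literal (e i).1 (E_ i) `&` literal (e i).2 (H_ i)))%O.

(* Value of the 0/1 indicator of X on the constituent C.  It is used only for
   X among the E_i and H_i, so C lies below exactly one of X and ~` X. *)
Definition indicator (C X : T) : R := ((C <= X)%O)%:R.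

Definition gain (S : {set 'I_n}) (s : 'I_n -> R) (C : T) : R :=
  \sum_(i in S) s i * indicator C (H_ i) * (indicator C (E_ i) - tnth p i).

Definition gain_values (S : {set 'I_n}) (s : 'I_n -> R) : seq R :=
  [seq gain S s (signed_meet e) | e : {ffun 'I_n -> bool * bool} in
     [pred e | (signed_meet e != \bot)%O &
               (signed_meet e <= \join_(i in S) H_ i)%O]].

(* Minimum and maximum of a nonempty list.  gain_values S s is nonempty when
   S is, because no conditioning event is \bot. *)
Definition seq_min (D : seq R) : R := \big[Num.min/head 0 D]_(v <- D) v.
Definition seq_max (D : seq R) : R := \big[Num.max/head 0 D]_(v <- D) v.

Definition coherent : Prop :=
  forall (S : {set 'I_n}) (s : 'I_n -> R), S != finset.set0 ->
    seq_min (gain_values S s) <= 0 <= seq_max (gain_values S s).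

End Coherence.

Section Biconditional.
Variables (d : Order.disp_t) (T : ctbDistrLatticeType d) (A B : T).
Hypothesis AB_indep : logically_independent A B.

Lemma logindep_neq0l : (A != \bot)%O.
Proof. by case: AB_indep => + _ _ _; apply: contra_neq => ->; rewrite meet0x. Qed.

Lemma logindep_neq0r : (B != \bot)%O.
Proof. by case: AB_indep => + _ _ _; apply: contra_neq => ->; rewrite meetx0. Qed.

Lemma logindep_join_neq0 : (A `|` B != \bot)%O.
Proof.
by apply: contraNneq logindep_neq0l => AUB0; rewrite -lex0 -AUB0 leUl.
Qed.

(* A | B *)
Definition cond_AB : cond_event T := CondEvent A logindep_neq0r.
(* B | A *)
Definition cond_BA : cond_event T := CondEvent B logindep_neq0l.
(* A || B = (A B) | (A \/ B) *)
Definition bicond : cond_event T := CondEvent (A `&` B)%O logindep_join_neq0.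

End Biconditional.

Definition Dset (R : realType) (z : R) : set (R * R) :=
  if z == 0 then
    [set xy : R * R | [/\ 0 <= xy.1 <= 1, 0 <= xy.2 <= 1 &
                          xy.1 = 0 \/ xy.2 = 0]]%classic
  else
    [set xy : R * R | [/\ 0 <= xy.1 <= 1, 0 <= xy.2 <= 1, z <= xy.1 <= 1 &
                          xy.2 = xy.1 * z / (xy.1 - z + xy.1 * z)]]%classic.

(* Main.v *)
(* With stakes s0, s1, s2 the gain is s0(1-x) + s1(1-y) + s2(1-z) on AB,
   - s1 y - s2 z on A~B and - s0 x - s2 z on ~AB.  The stakes
   (y, x, -(x + y - xy)) make the three gains equal, so coherence forces
   xy = z(x + y - xy), which is the equation of the theorem cleared of its
   denominator; the stakes (-1, -1, 1) rule out x = y = 0 < z.  Conversely,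
   nonnegative weights on the active constituents that annihilate the gain for
   all stakes prevent it from having a constant sign: xy, x(1-y), y(1-x) when
   x, y > 0, a single constituent when xy = 0, and x, 1-x (or y, 1-y) when only
   A|B (or only B|A) is in play. *)
Require Import Defs.
From mathcomp Require Import all_boot all_order all_algebra.
From mathcomp Require Import classical_sets reals.
From mathcomp Require Import ring lra.

Import Order.Theory GRing.Theory Num.Theory.

Local Open Scope ring_scope.

(** * Signs of the extrema of a finite list *)

Section ListExtrema.
Variable R : realType.
Implicit Type D : seq R.

(** The default value [head 0 D] is itself an entry of a nonempty list, so it adds no alternative to
    the disjunction over the entries. *)
Lemma seq_min_le D (t : R) :
  D != [::] -> (seq_min D <= t) = has (fun v => v <= t) D.
Proof.
have min_le x D' :
    (\big[Num.min/x]_(v <- D') v <= t) = (x <= t) || has (fun v => v <= t) D'.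
  elim: D' => [|v D' IH]; first by rewrite big_nil orbF.
  by rewrite big_cons ge_min IH orbCA.
by case: D => // v D _; rewrite /seq_min min_le /= orbA orbb.
Qed.

Lemma seq_max_ge D (t : R) :
  D != [::] -> (t <= seq_max D) = has (fun v => t <= v) D.
Proof.
have le_max_of x D' :
    (t <= \big[Num.max/x]_(v <- D') v) = (t <= x) || has (fun v => t <= v) D'.
  elim: D' => [|v D' IH]; first by rewrite big_nil orbF.
  by rewrite big_cons le_max IH orbCA.
by case: D => // v D _; rewrite /seq_max le_max_of /= orbA orbb.
Qed.

End ListExtrema.

(** * Truth values of events on a constituent *)

Section Constituents.
Variables (d : Order.disp_t) (T : ctbDistrLatticeType d).
Implicit Types (C X Y : T) (a b : bool).

(** A nonimpossible event cannot lie below both [X] and its complement. *)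
Lemma le_literalE C X b : (C != \bot)%O -> (C <= literal b X)%O -> (C <= X)%O = b.
Proof.
move=> C0; case: b => //= CX; apply: contraNF C0 => CX'.
by rewrite -lex0 -(meetxC X) lexI CX' CX.
Qed.

Lemma le_literal_join C X Y a b : (C != \bot)%O ->
  (C <= literal a X)%O -> (C <= literal b Y)%O -> (C <= X `|` Y)%O = a || b.
Proof.
move=> C0; case: a => [/= CX _|CX]; first exact: lexU2 (introT orP (or_introl CX)).
case: b => [/= CY|CY]; first exact: lexU2 (introT orP (or_intror CY)).
by apply: (@le_literalE _ _ false) => //=; rewrite complU lexI CX CY.
Qed.

Variables (n : nat) (F : n.-tuple (cond_event T)).
Variable e : {ffun 'I_n -> bool * bool}.
Hypothesis e_neq0 : (signed_meet F e != \bot)%O.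

Lemma signed_meet_le i :
  (signed_meet F e <= literal (e i).1 (event (tnth F i)))%O /\
  (signed_meet F e <= literal (e i).2 (conditioning (tnth F i)))%O.
Proof.
apply/andP; rewrite -lexI; exact: (@meets_inf _ _ _ i).
Qed.

Lemma signed_meet_event i : (signed_meet F e <= event (tnth F i))%O = (e i).1.
Proof. exact: le_literalE e_neq0 (signed_meet_le i).1. Qed.

Lemma signed_meet_conditioning i :
  (signed_meet F e <= conditioning (tnth F i))%O = (e i).2.
Proof. exact: le_literalE e_neq0 (signed_meet_le i).2. Qed.

Lemma signed_meet_le_joins (S : {set 'I_n}) :
  (signed_meet F e <= \join_(i in S) conditioning (tnth F i))%O
  = [exists (i | i \in S), (e i).2].
Proof.
case: existsP => [[i /andP[iS ei]]|eS].
  by have := (signed_meet_le i).2; rewrite ei => /le_trans; apply; apply: joins_sup.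
(* If no conditioning event in [S] holds on the constituent, it lies below all their complements,
   hence below the complement of their join. *)
apply: (@le_literalE _ _ false) => //=.
rewrite compl_joins; apply: meets_ge => i iS.
have := (signed_meet_le i).2; case ei: (e i).2 => //= _.
by case: eS; exists i; rewrite iS.
Qed.

Lemma gain_signed_meet (R : realType) (p : n.-tuple R) (S : {set 'I_n})
    (s : 'I_n -> R) :
  gain F p S s (signed_meet F e) =
  \sum_(i in S) s i * ((e i).2)%:R * (((e i).1)%:R - tnth p i).
Proof.
by apply: eq_bigr => i _;
  rewrite /indicator signed_meet_event signed_meet_conditioning.
Qed.

End Constituents.

Definition i0 : 'I_3 := @Ordinal 3 0 isT.
Definition i1 : 'I_3 := @Ordinal 3 1 isT.
Definition i2 : 'I_3 := @Ordinal 3 2 isT.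

Lemma ord3P (P : 'I_3 -> Prop) : P i0 -> P i1 -> P i2 -> forall i, P i.
Proof.
move=> P0 P1 P2 [[|[|[|//]]] lti].
- by rewrite (bool_irrelevance lti isT).
- by rewrite (bool_irrelevance lti isT).
- by rewrite (bool_irrelevance lti isT).
Qed.

(** * Constituents and gains for A|B, B|A and A||B *)

Section Biconditional.
Variables (d : Order.disp_t) (T : ctbDistrLatticeType d) (A B : T).
Hypothesis AB_indep : logically_independent A B.

Let F := [tuple cond_AB AB_indep; cond_BA AB_indep; bicond AB_indep].

(* Truth values of (event, conditioning event) for A|B, B|A, A||B, in this
   order, on the constituent where A and B have truth values [a] and [b]. *)
Definition bicond_values (a b : bool) : {ffun 'I_3 -> bool * bool} :=
  [ffun i : 'I_3 => nth (a, b) [:: (a, b); (b, a); (a && b, a || b)] i].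

(** Logical independence makes the meet of the two literals of [A] and [B] nonimpossible, and this
    meet lies below every factor of the signed meet. *)
Lemma signed_meet_bicond_values a b :
  (signed_meet F (bicond_values a b) != \bot)%O.
Proof.
have C0 : (literal a A `&` literal b B != \bot)%O.
  by case: AB_indep; case: a; case: b.
apply: contraNneq C0 => e0; rewrite -lex0 -e0.
apply: meets_ge => i _; rewrite ffunE (tnth_nth (cond_AB AB_indep)).
elim/ord3P: i => /=.
- by [].
- by rewrite meetC.
- rewrite lexI; case: a b {e0} => -[]; rewrite /= ?complI ?complU //.
  + by rewrite lexx (le_trans (leIl _ _)) ?leUl.
  + by rewrite (le_trans (leIr _ _)) ?leUr //= (le_trans (leIl _ _)) ?leUl.
  + by rewrite (le_trans (leIl _ _)) ?leUl //= (le_trans (leIr _ _)) ?leUr.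
  + by rewrite lexx (le_trans (leIl _ _)) ?leUl.
Qed.

Lemma bicond_valuesP (e : {ffun 'I_3 -> bool * bool}) :
  (signed_meet F e != \bot)%O -> exists a b, e = bicond_values a b.
Proof.
move=> e0; set C := signed_meet F e in e0.
have ev := signed_meet_event _ _ _ _ _ e0.
have co := signed_meet_conditioning _ _ _ _ _ e0.
have lit := signed_meet_le _ _ _ F e.
(* [A] is the event of A|B and [B] that of B|A; these two truth values determine the other four. *)
exists (e i0).1, (e i1).1; apply/ffunP => i; rewrite ffunE.
have [A0 _] := lit i0; have [B1 _] := lit i1.
elim/ord3P: i => /=.
- rewrite [LHS]surjective_pairing.
  by rewrite -(co i0) -(ev i1).
- rewrite [LHS]surjective_pairing.
  by rewrite -(co i1) -(ev i0).
- rewrite [LHS]surjective_pairing.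
  rewrite -(co i2) -(ev i2) -/C; congr (_, _).
    by rewrite (lexI C A B) -(ev i0) -(ev i1).
  exact: le_literal_join e0 A0 B1.
Qed.

Section Gains.
Variable R : realType.

Definition active (S : {set 'I_3}) a b :=
  [exists (i | i \in S), (bicond_values a b i).2].

Definition bicond_gain (p : 3.-tuple R) (S : {set 'I_3}) (s : 'I_3 -> R) a b :=
  \sum_(i in S) s i * ((bicond_values a b i).2)%:R *
                (((bicond_values a b i).1)%:R - tnth p i).

(** The constituents are exactly the four given by [bicond_values], and [active] selects those
    inside the join of the conditioning events of [S]. *)
Lemma coherent_gainP (p : 3.-tuple R) :
  coherent F p <->
  forall (S : {set 'I_3}) (s : 'I_3 -> R), S != finset.set0 ->
    (exists a b, active S a b && (bicond_gain p S s a b <= 0)) /\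
    (exists a b, active S a b && (0 <= bicond_gain p S s a b)).
Proof.
have gainP (S : {set 'I_3}) s (P : pred R) : reflect
    (exists a b, active S a b && P (bicond_gain p S s a b))
    (has P (gain_values F p S s)).
  apply: (iffP hasP) => [[v vD Pv]|[a [b /andP[act Pv]]]].
    case/mapP: vD => e; rewrite mem_enum => eC vE; move: eC.
    rewrite inE => /andP[e0]; rewrite signed_meet_le_joins // => act.
    have [a [b eE]] := bicond_valuesP e e0; exists a, b.
    by rewrite /active /bicond_gain -eE -(gain_signed_meet _ _ _ _ _ e0) act -vE.
  have e0 := signed_meet_bicond_values a b.
  exists (gain F p S s (signed_meet F (bicond_values a b))).
    by apply: map_f; rewrite mem_enum inE e0 signed_meet_le_joins.
  by rewrite gain_signed_meet.
have nonempty (S : {set 'I_3}) s : S != finset.set0 -> gain_values F p S s != [::].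
  case/set0Pn=> i iS; have : has xpredT (gain_values F p S s).
    (* AB lies in all three conditioning events, so it is active for every nonempty [S]. *)
    apply/gainP; exists true, true; rewrite andbT; apply/existsP; exists i.
    by rewrite iS ffunE; elim/ord3P: i {iS}.
  by case: gain_values.
split=> coh S s S0.
  have := coh S s S0; rewrite seq_min_le ?seq_max_ge ?nonempty //.
  by case/andP => /gainP ? /gainP.
rewrite seq_min_le ?seq_max_ge ?nonempty //.
by have [? ?] := coh S s S0; apply/andP; split; apply/gainP.
Qed.

Lemma bicond_gainE (x y z : R) (S : {set 'I_3}) (s : 'I_3 -> R) a b :
  let c i := if i \in S then s i else 0 in
  bicond_gain [tuple x; y; z] S s a b =
  c i0 * b%:R * (a%:R - x) + c i1 * a%:R * (b%:R - y)
  + c i2 * (a || b)%:R * ((a && b)%:R - z).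
Proof.
move=> c; have i0E : ord0 = i0 by apply: val_inj.
have i1E : lift ord0 ord0 = i1 by apply: val_inj.
have i2E : lift ord0 (lift ord0 ord0) = i2 by apply: val_inj.
rewrite /bicond_gain big_mkcond !big_ord_recl big_ord0 /= addr0 addrA.
rewrite i2E i1E i0E !ffunE !(tnth_nth 0) /= /c.
by do !case: ifP => _; rewrite ?mul0r.
Qed.

Lemma activeE (S : {set 'I_3}) a b :
  active S a b = [|| (i0 \in S) && b, (i1 \in S) && a | (i2 \in S) && (a || b)].
Proof.
apply/existsP/or3P => [[i]|].
  rewrite ffunE; elim/ord3P: i => /= act.
  - exact: Or31.
  - exact: Or32.
  - exact: Or33.
by case=> act; [exists i0|exists i1|exists i2]; rewrite ffunE.
Qed.

(** If the gain were positive on every active constituent, each weighted term would be nonnegative;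
    a zero total would then force all weights to vanish, against their positive sum. The other sign
    follows by applying this to [- g]. *)
Lemma balanced_gain_signs (p : 3.-tuple R) (S : {set 'I_3}) s (w11 w10 w01 : R) :
  let g := bicond_gain p S s in
  0 <= w11 -> 0 <= w10 -> 0 <= w01 -> 0 < w11 + w10 + w01 ->
  (0 < w11 -> active S true true) -> (0 < w10 -> active S true false) ->
  (0 < w01 -> active S false true) ->
  w11 * g true true + w10 * g true false + w01 * g false true = 0 ->
  (exists a b, active S a b && (g a b <= 0)) /\
  (exists a b, active S a b && (0 <= g a b)).
Proof.
move=> g w11_ge0 w10_ge0 w01_ge0 w_gt0 act11 act10 act01 wg0.
have sign (h : bool -> bool -> R) :
    w11 * h true true + w10 * h true false + w01 * h false true = 0 ->
    exists a b, active S a b && (h a b <= 0).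
  move=> wh0.
  have term (w t : R) :
      0 <= w -> (0 < w -> 0 < t) -> 0 <= w * t /\ (w * t = 0 -> w = 0).
    rewrite le_eqVlt => /predU1P[<- _|w_pos /(_ w_pos) t_pos].
      by rewrite mul0r.
    by have wt := mulr_gt0 w_pos t_pos; split=> [|wt0]; lra.
  have [act_h|h11] := boolP (active S true true && (h true true <= 0)).
    by exists true, true.
  have [act_h|h10] := boolP (active S true false && (h true false <= 0)).
    by exists true, false.
  have [act_h|h01] := boolP (active S false true && (h false true <= 0)).
    by exists false, true.
  have pos a b (w : R) : (0 < w -> active S a b) ->
      ~~ (active S a b && (h a b <= 0)) -> 0 < w -> 0 < h a b.
    by move=> act + /act act_ab; rewrite act_ab -ltNge.
  have [t11 e11] := term _ _ w11_ge0 (pos _ _ _ act11 h11).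
  have [t10 e10] := term _ _ w10_ge0 (pos _ _ _ act10 h10).
  have [t01 e01] := term _ _ w01_ge0 (pos _ _ _ act01 h01).
  have w11_0 : w11 = 0 by apply: e11; lra.
  have w10_0 : w10 = 0 by apply: e10; lra.
  have w01_0 : w01 = 0 by apply: e01; lra.
  by move: w_gt0; rewrite w11_0 w10_0 w01_0 !addr0 ltxx.
split; first exact: sign.
have [|a [b]] := sign (fun a b => - g a b); first by lra.
by rewrite oppr_le0; exists a, b.
Qed.

End Gains.

End Biconditional.

(** Clearing the denominator admits the spurious solution x = y = 0 when z > 0; the last conjunct
    excludes it. *)
Lemma DsetP (R : realType) (x y z : R) : 0 <= z <= 1 ->
  Dset z (x, y) <->
  [/\ 0 <= x <= 1, 0 <= y <= 1, x * y = z * (x + y - x * y)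
    & z = 0 \/ 0 < x /\ 0 < y].
Proof.
case/andP=> z0 z1; rewrite /Dset; have [-> | zN0] := eqVneq z 0.
  split=> [[/= x01 y01 xy0] | [x01 y01 xyz _]].
    by split=> //; [case: xy0 => ->; ring | left].
  split=> //=; move/eqP: xyz; rewrite mul0r mulf_eq0.
  by case/orP=> /eqP; [left | right].
have {z0} zgt0 : 0 < z by rewrite lt_neqAle eq_sym zN0.
split=> [[/= x01 y01 /andP[zx _] yE] | [x01 y01 xyz pos]].
  have xgt0 : 0 < x by lra.
  have xz : 0 < x * z by rewrite mulr_gt0.
  have den : 0 < x - z + x * z by lra.
  have ygt0 : 0 < y by rewrite yE divr_gt0.
  split=> //; last by right.
  have : y * (x - z + x * z) = x * z by rewrite yE divfK // gt_eqF.
  lra.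
case: pos => [zE | [xgt0 ygt0]]; first by rewrite zE eqxx in zN0.
have xz : 0 < x * z by rewrite mulr_gt0.
have zx : z <= x.
  (* The bound z <= x follows from xy - zy = zx(1 - y) >= 0. *)
  rewrite -(ler_pM2r ygt0) xyz -subr_ge0.
  have -> : z * (x + y - x * y) - z * y = z * (x * (1 - y)) by ring.
  by rewrite mulr_ge0 ?mulr_ge0 //; lra.
split=> //=; first by rewrite zx; lra.
by apply: (@mulIf _ (x - z + x * z)); [|rewrite divfK]; lra.
Qed.

Theorem theorem9 (R : realType) (d : Order.disp_t) (T : ctbDistrLatticeType d)
    (A B : T) (AB_indep : logically_independent A B)
    (z : R) (z01 : 0 <= z <= 1) (x y : R) :
  coherent [tuple cond_AB AB_indep; cond_BA AB_indep; bicond AB_indep]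
           [tuple x; y; z]
  <-> Dset z (x, y).
Proof.
rewrite coherent_gainP DsetP //; case/andP: (z01) => z0 z1.
pose stakes (s0 s1 s2 : R) (i : 'I_3) := nth 0 [:: s0; s1; s2] i.
split=> [coh | [/andP[x0 x1] /andP[y0 y1] xyz pos] S s S0].
- have single0 := coh [set i0] (stakes 1 0 0).
  have single1 := coh [set i1] (stakes 0 1 0).
  have all3 s0 s1 s2 := coh [set: 'I_3] (stakes s0 s1 s2).
  have nonempty (i : 'I_3) : [set i] != finset.set0.
    by apply/set0Pn; exists i; rewrite inE.
  have x01 : 0 <= x <= 1.
    (* With unit stake on A|B alone, the active gains are 1 - x and - x. *)
    have [[a [b g_le0]] [a' [b' g_ge0]]] := single0 (nonempty _).
    move: g_le0 g_ge0; rewrite !activeE !bicond_gainE !inE /stakes /=.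
    by case: a b a' b' => -[] [] [] //=; lra.
  have y01 : 0 <= y <= 1.
    have [[a [b g_le0]] [a' [b' g_ge0]]] := single1 (nonempty _).
    move: g_le0 g_ge0; rewrite !activeE !bicond_gainE !inE /stakes /=.
    by case: a b a' b' => -[] [] [] //=; lra.
  have setT0 : [set: 'I_3] != finset.set0.
    by apply/set0Pn; exists i0; rewrite inE.
  have xyz : x * y = z * (x + y - x * y).
    (* The common value of the three gains is z(x + y - xy) - xy, which must be both <= 0 and >=
       0. *)
    have [[a [b g_le0]] [a' [b' g_ge0]]] := all3 y x (- (x + y - x * y)) setT0.
    move: g_le0 g_ge0; rewrite !activeE !bicond_gainE !inE /stakes /=.
    by case: a b a' b' => -[] [] [] //=; lra.
  have [_ [a [b]]] := all3 (-1) (-1) 1 setT0.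
  rewrite !activeE !bicond_gainE !inE /stakes /= => gain_ge0.
  split=> //; have [-> | zN0] := eqVneq z 0; first by left.
  have zgt0 : 0 < z by rewrite lt_neqAle eq_sym zN0.
  have [x0|xN0] := eqVneq x 0.
    (* At x = y = 0 the stakes (-1, -1, 1) give the gains -1 - z, - z and - z, all negative. *)
    suff y0 : y = 0.
      by exfalso; case: a b gain_ge0 => -[] //=; rewrite x0 y0; lra.
    by apply: (@mulfI _ z) => //; move: xyz; rewrite x0; lra.
  have [y0|yN0] := eqVneq y 0.
    by case/eqP: xN0; apply: (@mulfI _ z) => //; move: xyz; rewrite y0; lra.
  by right; rewrite !lt_neqAle !(eq_sym 0) xN0 yN0; lra.
(* In the first case the conditioning events in [S] join to [A] \/ [B], so all three constituents
   are active; otherwise [S] is the singleton of A|B or of B|A. *)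
have [S2|] := boolP ((i2 \in S) || (i0 \in S) && (i1 \in S)).
  have act a b : a || b -> active S a b.
    move=> ab; rewrite activeE ab; case: a b ab => -[] // _; move: S2;
    by case: (i0 \in S); case: (i1 \in S); case: (i2 \in S).
  have [/andP[xgt0 ygt0]|xy0] := boolP ((0 < x) && (0 < y)).
    (* Up to normalization, these weights are the probabilities of AB, A~B and ~AB given [A] \/ [B]
       for which P(A|B) = x and P(B|A) = y. *)
    apply: (@balanced_gain_signs _ _ _ _ (x * y) (x * (1 - y)) (y * (1 - x)));
      rewrite ?act //.
    - by apply: mulr_ge0.
    - by apply: mulr_ge0; lra.
    - by apply: mulr_ge0; lra.
    - apply: ltr_wpDr; first by apply: mulr_ge0; lra.
      by apply: ltr_wpDr; [apply: mulr_ge0; lra | exact: mulr_gt0].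
    rewrite !bicond_gainE /=; set c0 := if i0 \in S then _ else _.
    set c1 := if i1 \in S then _ else _; set c2 := if i2 \in S then _ else _.
    transitivity (c2 * (x * y - z * (x + y - x * y))); first by ring.
    by rewrite -xyz subrr mulr0.
  have z_eq0 : z = 0 by case: pos => // -[xgt0 ygt0]; rewrite xgt0 ygt0 in xy0.
  have {}xy0 : x = 0 \/ y = 0.
    by move/eqP: xyz; rewrite z_eq0 mul0r mulf_eq0 => /orP[]/eqP; [left|right].
  case: xy0 => [x_eq0|y_eq0].
    (* With x = z = 0 the gain on ~AB is zero; with y = z = 0 the one on A~B is. *)
    apply: (@balanced_gain_signs _ _ _ _ 0 0 1);
      rewrite ?act ?lexx ?ler01 ?addr0 ?add0r //.
    by rewrite !bicond_gainE x_eq0 z_eq0 /=; ring.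
  apply: (@balanced_gain_signs _ _ _ _ 0 1 0);
    rewrite ?act ?lexx ?ler01 ?addr0 ?add0r //.
  by rewrite !bicond_gainE y_eq0 z_eq0 /=; ring.
rewrite negb_or => /andP[/negbTE S2 S01].
have [S0f|S0f] := boolP (i0 \in S).
  have S1 : (i1 \in S) = false by apply/negbTE; move: S01; rewrite S0f.
  (* The weights of AB and ~AB are the probabilities of [A] and ~[A] given [B]. *)
  apply: (@balanced_gain_signs _ _ _ _ x 0 (1 - x));
    rewrite ?activeE ?bicond_gainE ?S0f ?S1 ?S2 //=; lra.
have S1 : i1 \in S.
  by case/set0Pn: S0; apply: ord3P; rewrite ?S2 ?(negbTE S0f).
apply: (@balanced_gain_signs _ _ _ _ y (1 - y) 0);
  rewrite ?activeE ?bicond_gainE ?(negbTE S0f) ?S1 ?S2 //=; lra.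
Qed.
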